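(* Let $k$ be a field and $x_1,\ldots,x_n$ variables over $k$. Let $I=(f_1,\ldots,f_s)$ be an ideal of $R=k[x_1,\ldots,x_n]$. Then there exist a polynomial ring $S=R[y_1,\ldots,y_r]$ and a surjective homomorphism of $R$-algebras $\sigma:S\to R$ such that $\sigma^{-1}(I)$ is an ideal of $S$ generated by trinomials and such that $\mathrm{rt}(I)=\mathrm{rt}(\sigma^{-1}(I))$.
   Context: A trinomial is a polynomial (here, in the variables $x_1,\ldots,x_n,y_1,\ldots,y_r$ over $k$) with at most three terms. Relation type of an ideal: let $I=(f_1,\ldots,f_s)$ be an ideal of a Noetherian (commutative) ring $R$, and let $\mathbf{R}(I)=R[It]=\bigoplus_{q\ge 0}I^qt^q$ be its Rees algebra. Let $R[t_1,\ldots,t_s]$ be the polynomial ring with its standard grading ($\deg t_i=1$, elements of $R$ in degree $0$), let $\varphi:R[t_1,\ldots,t_s]\to\mathbf{R}(I)$ be the graded $R$-algebra homomorphism sending $t_i$ to $f_it$, and let $L=\ker(\varphi)=\bigoplus_{q\ge 1}L_q$. The relation type $\mathrm{rt}(I)$ is the least integer $N\ge 1$ such that $L$ is generated by its homogeneous elements of degree at most $N$. It is a known fact that $\mathrm{rt}(I)$ does not depend on the chosen finite generating set of $I$. The improper ideal has relation type $1$. *)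

(* Defs.v *)
From mathcomp Require Import all_boot all_order all_algebra.
From mathcomp Require Import mpoly.
Set Implicit Arguments.
Unset Strict Implicit.
Unset Printing Implicit Defensive.
Import GRing.Theory.
Local Open Scope ring_scope.

Definition ideal_gen (A : comNzRingType) (X : A -> Prop) (a : A) : Prop :=
  exists (l : nat) (c x : 'I_l -> A),
    (forall i, X (x i)) /\ a = \sum_(i < l) c i * x i.

Definition ideal_of (A : comNzRingType) (s : nat) (f : 'I_s -> A) : A -> Prop :=
  ideal_gen (fun a => exists i, a = f i).

(* The Rees algebra A[It] is a subring of A[t] = {poly A}; taking the codomain
   of phi to be A[t] does not change its kernel. *)
Definition rees_map (A : comNzRingType) (s : nat) (f : 'I_s -> A)
    (P : {mpoly A[s]}) : {poly A} :=
  mmap (@polyC A) (fun i => (f i)%:P * 'X) P.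

Definition rees_ker (A : comNzRingType) (s : nat) (f : 'I_s -> A)
    (P : {mpoly A[s]}) : Prop :=
  rees_map f P = 0.

Definition rees_ker_gen_upto (A : comNzRingType) (s : nat) (f : 'I_s -> A)
    (N : nat) : Prop :=
  forall P, rees_ker f P ->
    ideal_gen (fun Q => rees_ker f Q /\
                        exists2 q, (q <= N)%N & Q \is q.-homog) P.

(* rt(J) = N.  The value does not depend on the finite generating family, so it
   is computed on some family; it exists when A is Noetherian. *)
Definition has_relation_type (A : comNzRingType) (J : A -> Prop) (N : nat) :
    Prop :=
  exists (s : nat) (f : 'I_s -> A),
    [/\ forall a, J a <-> ideal_of f a,
        (1 <= N)%N,
        rees_ker_gen_upto f N
      & forall M, (1 <= M)%N -> rees_ker_gen_upto f M -> (N <= M)%N].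

(* For p in k[x_1..x_n][y_1..y_r], the number of terms of p as a polynomial over
   k in the n + r variables x, y. *)
Definition nterms (k : fieldType) (n r : nat)
    (p : {mpoly {mpoly k[n]}[r]}) : nat :=
  (\sum_(m <- msupp p) size (msupp p@_m))%N.

Definition trinomial (k : fieldType) (n r : nat)
    (p : {mpoly {mpoly k[n]}[r]}) : Prop :=
  (nterms p <= 3)%N.

(* Main.v *)
From HB Require Import structures.
Require Import Defs.
From mathcomp Require Import all_boot all_order all_algebra.
From mathcomp Require Import mpoly ring.
From Stdlib Require Import Classical ClassicalEpsilon.
Set Implicit Arguments.
Unset Strict Implicit.
Unset Printing Implicit Defensive.
Import GRing.Theory.
Local Open Scope ring_scope.

(** Write f_1, ..., f_s as differences of partial sums of one sequence of terms
    tau_0, tau_1, ..., put a_j = tau_0 + ... + tau_(j-1), and let sigma be the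
    evaluation y_j |-> a_j.  The kernel of sigma is generated by the y_j - a_j,
    hence also by y_0 and the trinomials y_(j+1) - y_j - tau_j, and each f_i
    lifts to a binomial y_e - y_b.

    After the change of variables z_j = y_j - a_j, the ideal sigma^-1(I) becomes
    (I, z_1, ..., z_r), so it suffices to show rt(I, z) = rt(I) for one new
    variable z over an arbitrary ring.  The equations of (f_1, ..., f_s, z) are
    generated by those of f and the linear ones z t_j - f_j u: modulo the latter
    every polynomial in z, t, u is a sum of monomials not divisible by any
    z t_j, and on such polynomials the Rees map separates the powers of z and u
    well enough to read off a vanishing image coefficientwise.

    Hilbert's basis theorem guarantees that rt(I) exists. *)

Definition is_ideal (A : comNzRingType) (J : A -> Prop) : Prop :=
  [/\ J 0, forall a b, J a -> J b -> J (a + b) & forall c a, J a -> J (c * a)].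

(** * Ideals and induction on polynomials *)

Section Ideals.
Variable A : comNzRingType.
Implicit Types (J X : A -> Prop) (a b c : A).

Lemma idealB J a b : is_ideal J -> J a -> J b -> J (a - b).
Proof. by case=> _ JD JM Ja Jb; apply: JD => //; rewrite -mulN1r; apply: JM. Qed.

Lemma ideal_sum J l (x : 'I_l -> A) :
  is_ideal J -> (forall i, J (x i)) -> J (\sum_(i < l) x i).
Proof. by case=> J0 JD _ Jx; apply: big_ind. Qed.

Lemma ideal_gen_sub X a : X a -> ideal_gen X a.
Proof.
move=> Xa; exists 1%N, (fun=> 1), (fun=> a); split=> //.
by rewrite big_ord1 mul1r.
Qed.

Lemma ideal_gen_ideal X : is_ideal (ideal_gen X).
Proof.
split.
- have nox (T : Type) : 'I_0 -> T by case.
  by exists 0%N, (nox _), (nox _); split; [case | rewrite big_ord0].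
- move=> a b [l [c [x [Xx ->]]]] [l' [c' [x' [Xx' ->]]]].
  exists (l + l')%N,
    (fun i => match split i with inl j => c j | inr j => c' j end),
    (fun i => match split i with inl j => x j | inr j => x' j end).
  split=> [i|]; first by case: split.
  rewrite big_split_ord /=; congr (_ + _); apply: eq_bigr => i _.
    case: splitP => j /= e; first by rewrite (val_inj e).
    by move: (ltn_ord i); rewrite e ltnNge leq_addr.
  case: splitP => j /= e; first by move: (ltn_ord j); rewrite -e ltnNge leq_addr.
  by rewrite (_ : i = j) //; apply/val_inj/eqP; rewrite -(eqn_add2l l) e.
- move=> d a [l [c [x [Xx ->]]]]; exists l, (fun i => d * c i), x; split=> //.
  by rewrite mulr_sumr; apply: eq_bigr => i _; rewrite mulrA.
Qed.

Lemma ideal_gen_min J X a :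
  is_ideal J -> (forall x, X x -> J x) -> ideal_gen X a -> J a.
Proof.
move=> idJ XJ [l [c [x [Xx ->]]]]; apply: ideal_sum => // i.
by case: idJ => _ _ JM; apply/JM/XJ.
Qed.

Lemma ideal_gen_mono X X' a :
  (forall x, X x -> X' x) -> ideal_gen X a -> ideal_gen X' a.
Proof.
move=> XX'; apply: ideal_gen_min; first exact: ideal_gen_ideal.
by move=> x /XX' /ideal_gen_sub.
Qed.

Lemma ideal_of_ideal s (f : 'I_s -> A) : is_ideal (ideal_of f).
Proof. exact: ideal_gen_ideal. Qed.

Lemma ideal_of_gen s (f : 'I_s -> A) i : ideal_of f (f i).
Proof. by apply: ideal_gen_sub; exists i. Qed.

Lemma ideal_of_min J s (f : 'I_s -> A) a :
  is_ideal J -> (forall i, J (f i)) -> ideal_of f a -> J a.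
Proof. by move=> idJ Jf; apply: ideal_gen_min => // x [i ->]. Qed.

End Ideals.

Lemma ideal_preim (A B : comNzRingType) (h : {rmorphism A -> B}) (J : B -> Prop) :
  is_ideal J -> is_ideal (fun a => J (h a)).
Proof.
case=> J0 JD JM; split=> [|a b Ja Jb|c a Ja]; first by rewrite rmorph0.
  by rewrite rmorphD; apply: JD.
by rewrite rmorphM; apply: JM.
Qed.

Section MPolyInd.
Variables (n : nat) (A : comNzRingType).

(** Induction along the ring operations rather than over monomials, suited to properties stable
    under sums, scalars and variables. Zero is reached as 0 times 1. *)
Lemma mpoly_ring_ind (P : {mpoly A[n]} -> Prop) :
  P 1 -> (forall p q, P p -> P q -> P (p + q)) ->
  (forall c p, P p -> P (c%:MP * p)) -> (forall i p, P p -> P ('X_i * p)) ->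
  forall p, P p.
Proof.
move=> P1 PD PC PX; elim/mpolyind=> [|c m p _ _ Pp].
  by rewrite -(mul0r 1) -mpolyC0; apply: PC.
apply: PD => //; rewrite -mul_mpolyC; apply: PC; rewrite mpolyXE_id.
elim/big_rec: _ => // i q _ Pq.
by elim: (m i) => [|k IH]; rewrite ?mul1r // exprS -mulrA; apply: PX.
Qed.

Lemma mpoly_rmorph_ext (B : comNzRingType) (g h : {rmorphism {mpoly A[n]} -> B}) :
  (forall c, g c%:MP = h c%:MP) -> (forall i, g 'X_i = h 'X_i) -> g =1 h.
Proof.
move=> ghC ghX; elim/mpoly_ring_ind => [|p q gp gq|c p gp|i p gp].
- by rewrite !rmorph1.
- by rewrite !rmorphD gp gq.
- by rewrite !rmorphM gp ghC.
- by rewrite !rmorphM gp ghX.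
Qed.

Lemma mmapXU (B : comNzRingType) (h : {rmorphism A -> B}) (v : 'I_n -> B) i :
  mmap h v 'X_i = v i.
Proof. by rewrite mmapX mmap1U. Qed.

End MPolyInd.

Lemma poly_rmorph_ext (A B : comNzRingType) (g h : {rmorphism {poly A} -> B}) :
  (forall c, g c%:P = h c%:P) -> g 'X = h 'X -> g =1 h.
Proof.
move=> ghC ghX; elim/poly_ind => [|p c gp]; first by rewrite !rmorph0.
by rewrite !rmorphD !rmorphM gp ghX ghC.
Qed.

(** * Hilbert's basis theorem *)

Definition noetherian (A : comNzRingType) : Prop :=
  forall J : A -> Prop, is_ideal J ->
    exists s : seq A, forall a, J a <-> ideal_gen (fun x => x \in s) a.

Lemma noetherian_field (k : fieldType) : noetherian k.
Proof.
move=> J idJ; case: (classic (exists2 a, J a & a != 0)) => [[a Ja a0]|no].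
  exists [:: a] => b; split=> [_|].
    rewrite -(divfK a0 b); case: (ideal_gen_ideal (fun x => x \in [:: a])).
    by move=> _ _; apply; apply: ideal_gen_sub; rewrite inE.
  by apply: ideal_gen_min => // x; rewrite inE => /eqP->.
exists [::] => b; split=> [Jb|]; last exact: ideal_gen_min.
case: (eqVneq b 0) => [->|b0]; last by case: no; exists b.
by case: (ideal_gen_ideal (fun x : k => x \in [::])).
Qed.

Lemma noetherian_surj (A B : comNzRingType) (h : {rmorphism A -> B}) :
  (forall b, exists a, h a = b) -> noetherian A -> noetherian B.
Proof.
move=> h_surj noA J idJ; have [s Js] := noA _ (ideal_preim h idJ).
exists (map h s) => b; split.
  have [a <-] := h_surj b; move/Js.
  apply: (@ideal_gen_min _ (fun a => ideal_gen _ (h a))) => [|x xs].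
    exact/ideal_preim/ideal_gen_ideal.
  exact/ideal_gen_sub/map_f.
apply: ideal_gen_min => // x /mapP[a aS ->].
exact/Js/ideal_gen_sub.
Qed.

(** The ideals of the initial segments increase, so their union is an ideal. Its finitely many
    generators all lie in one stage n, which therefore contains [a n]. *)
Lemma noetherian_seq (A : comNzRingType) (a : nat -> A) :
  noetherian A ->
  exists n, ideal_gen (fun x => exists2 i, (i < n)%N & x = a i) (a n).
Proof.
move=> noA; pose X n x := exists2 i, (i < n)%N & x = a i.
have Xle m n x : (m <= n)%N -> ideal_gen (X m) x -> ideal_gen (X n) x.
  move=> le_mn; apply: ideal_gen_mono => y [i im ->].
  by exists i => //; apply: leq_trans le_mn.
pose J x := exists n, ideal_gen (X n) x.
have idJ : is_ideal J.
  split=> [|x y [m Xx] [n Xy]|c x [n Xx]].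
  - by exists 0%N; case: (ideal_gen_ideal (X 0%N)).
  - exists (maxn m n); case: (ideal_gen_ideal (X (maxn m n))) => _ XD _.
    by apply: XD; [apply: Xle Xx; rewrite leq_maxl | apply: Xle Xy; rewrite leq_maxr].
  - by exists n; case: (ideal_gen_ideal (X n)) => _ _; apply.
have [s Js] := noA J idJ.
have [n Xn] : exists n, forall x, x \in s -> ideal_gen (X n) x.
  have : forall x, x \in s -> J x by move=> x xs; apply/Js/ideal_gen_sub.
  elim: (s) => [|y t IH] Jyt; first by exists 0%N.
  have [|m Xm] := IH; first by move=> x xt; apply: Jyt; rewrite inE xt orbT.
  have [|n Xn] := Jyt y; first by rewrite inE eqxx.
  exists (maxn m n) => x; rewrite inE => /orP[/eqP->|/Xm Xx].
    by apply: Xle Xn; rewrite leq_maxr.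
  by apply: Xle Xx; rewrite leq_maxl.
exists n; apply: (ideal_gen_min (ideal_gen_ideal _) Xn); apply/Js.
by exists n.+1; apply: ideal_gen_sub; exists n.
Qed.

Lemma ex_minimal (T : Type) (P : T -> Prop) (m : T -> nat) :
  (exists x, P x) -> exists2 x, P x & forall y, P y -> (m x <= m y)%N.
Proof.
case=> x Px; move: {2}(m x) (leqnn (m x)) => n.
elim: n x Px => [|n IH] x Px le_n.
  by exists x => // y _; move: le_n; rewrite leqn0 => /eqP->.
case: (classic (exists2 y, P y & (m y < m x)%N)) => [[y Py lt]|no].
  by apply: (IH y Py); rewrite -ltnS; apply: leq_trans lt le_n.
exists x => // y Py; rewrite leqNgt; apply/negP => lt; apply: no; by exists y.
Qed.

(* If J were not finitely generated, one could choose
   p_n of least size in J \ (p_0, ..., p_(n-1)); a relation among the leading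
   coefficients then cancels the leading term of some p_n. *)
Lemma noetherian_poly (A : comNzRingType) : noetherian A -> noetherian {poly A}.
Proof.
move=> noA J idJ; apply: NNPP => nfg.
pose gen (s : seq {poly A}) := ideal_gen (fun x => x \in s).
pose sel (s : seq {poly A}) p :=
  [/\ J p, ~ gen s p & forall q, J q -> ~ gen s q -> (size p <= size q)%N].
(* The premise on [s] stays under the existential, with 0 as default, so that the choice function
   [next] is total. *)
have ex_sel s : exists p, (forall x, x \in s -> J x) -> sel s p.
  case: (classic (forall x, x \in s -> J x)) => [Js|nJs]; last by exists 0.
  have [|p [Jp Gp] p_min] := @ex_minimal _ (fun p => J p /\ ~ gen s p) size.
    apply: NNPP => no; apply: nfg; exists s => p; split=> [Jp|].
      by apply: NNPP => Gp; apply: no; exists p.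
    exact: ideal_gen_min.
  by exists p => _; split=> // q Jq Gq; apply: p_min.
pose next s := proj1_sig (constructive_indefinite_description _ (ex_sel s)).
have nextP s : (forall x, x \in s -> J x) -> sel s (next s).
  exact: (proj2_sig (constructive_indefinite_description _ (ex_sel s))).
pose L := fix L n := if n is m.+1 then next (L m) :: L m else [::].
pose p n := next (L n).
have LJ n x : x \in L n -> J x.
  elim: n x => [|n IH] x //=; rewrite inE => /orP[/eqP->|/IH//].
  by case: (nextP _ IH).
have pP n : sel (L n) (p n) by apply: nextP; apply: LJ.
have Lsub m n x : (m <= n)%N -> x \in L m -> x \in L n.
  move=> /subnK <-; elim: (n - m)%N => // d IH /IH; rewrite addSn /= inE => ->.
  by rewrite orbT.
have [n] := noetherian_seq (fun i => lead_coef (p i)) noA.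
case: (pP n) => Jp Gp p_min; set d := (size (p n)).-1.
have [G0 GD GM] : is_ideal (gen (L n)) by apply: ideal_gen_ideal.
have sp : (size (p n) = d.+1)%N.
  rewrite prednK // lt0n size_poly_eq0; apply/negP => /eqP p0.
  by apply: Gp; rewrite p0.
(* The coefficients available in degree d, the degree of [p n], from combinations of the earlier
   choices. The relation among leading coefficients will put that of [p n] in this ideal. *)
pose K a := exists q, [/\ gen (L n) q, (size q <= d.+1)%N & q`_d = a].
have idK : is_ideal K.
  split=> [|a b [q [Gq sq <-]] [r [Gr sr <-]]|c a [q [Gq sq <-]]].
  - by exists 0; rewrite size_poly0 coef0.
  - exists (q + r); split; rewrite ?coefD //; first exact: GD.
    by apply: leq_trans (size_polyD _ _) _; rewrite geq_max sq.
  - exists (c *: q); split; rewrite ?coefZ //.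
      by rewrite -mul_polyC; apply: GM.
    exact: leq_trans (size_scale_leq _ _) sq.
case/(ideal_gen_min idK) => [a [i lt_in ->]|q [Gq sq qd]].
  have [Ji Gi i_min] := pP i.
  have le_s : (size (p i) <= d.+1)%N.
    rewrite -sp; apply: i_min => // Gin; apply: Gp; move: Gin.
    by apply: ideal_gen_mono => x; apply: Lsub; apply: ltnW.
  (* Minimality of [p i] gives size at most d + 1, so a power of the variable raises it to degree d
     exactly. *)
  exists ('X^(d.+1 - size (p i)) * p i); split.
  - apply/GM/ideal_gen_sub; apply: (@Lsub i.+1) => //=; exact: mem_head.
  - apply: leq_trans (size_polyMleq _ _) _; rewrite size_polyXn addSn /=.
    by rewrite subnK.
  - rewrite coefXnM lead_coefE; case: ltnP => [|h]; last first.
      congr (_ `_ _); move: le_s h; case: (size (p i)) => [|e] /=.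
        by rewrite subn0 => _; rewrite ltnn.
      by rewrite ltnS subSS => le_e _; rewrite subKn.
    (* The shift exceeds d only if [p i] has size 0; then both coefficients vanish. *)
    case: (size (p i)) (size_poly_leq0 (p i)) => [/esym|e _]; last first.
      by rewrite subSS ltnNge leq_subr.
    by rewrite leqnn => /eqP-> _; rewrite coef0.
have Jq : J q by apply: ideal_gen_min Gq => // x /LJ.
(* The difference has smaller size than [p n] yet lies in J outside the ideal of the earlier
   choices, against minimality. *)
have := p_min (p n - q) (idealB idJ Jp Jq).
rewrite leqNgt => H; suff : ~~ (size (p n - q)%R < size (p n))%N.
  move/negP; apply; rewrite sp ltnS; apply/leq_sizeP => j le_dj.
  rewrite coefB; case: ltngtP le_dj => // [lt_dj|<-] _.
    by rewrite !(leq_sizeP _ _ _ _ lt_dj) ?subrr // sp.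
  by rewrite qd lead_coefE subrr.
apply: H => Gpq; apply: Gp; rewrite -(subrK q (p n)); exact: GD.
Qed.

(* Mutually inverse isomorphisms between A[y_0, ..., y_n] and A[y_1, ..., y_n][X]
   with X = y_0 - a. *)
Definition poly_to_mpoly (n : nat) (A : comNzRingType) (a : A) :
    {poly {mpoly A[n]}} -> {mpoly A[n.+1]} :=
  horner_eval ('X_ord0 - a%:MP) \o
  map_poly (mmap (@mpolyC n.+1 A) (fun j => 'X_(lift ord0 j))).

HB.instance Definition _ n A a :=
  GRing.RMorphism.copy (@poly_to_mpoly n A a)
    (horner_eval ('X_ord0 - a%:MP) \o
     map_poly (mmap (@mpolyC n.+1 A) (fun j => 'X_(lift ord0 j)))).

Definition mpoly_to_poly (n : nat) (A : comNzRingType) (a : A) :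
    {mpoly A[n.+1]} -> {poly {mpoly A[n]}} :=
  mmap (@polyC _ \o @mpolyC n A)
    (fun i => oapp (fun j => ('X_j)%:P) ('X + a%:MP%:P) (unlift ord0 i)).

HB.instance Definition _ n A a :=
  GRing.RMorphism.copy (@mpoly_to_poly n A a)
    (mmap (@polyC _ \o @mpolyC n A)
      (fun i => oapp (fun j => ('X_j)%:P) ('X + a%:MP%:P) (unlift ord0 i))).

Section MPolyPoly.
Variables (n : nat) (A : comNzRingType) (a : A).

Lemma poly_to_mpolyC c : poly_to_mpoly a c%:P =
  mmap (@mpolyC n.+1 A) (fun j => 'X_(lift ord0 j)) c.
Proof. by rewrite /poly_to_mpoly /= map_polyC /= /horner_eval hornerC. Qed.

Lemma poly_to_mpolyX : poly_to_mpoly (n := n) a 'X = 'X_ord0 - a%:MP.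
Proof. by rewrite /poly_to_mpoly /= map_polyX /horner_eval hornerX. Qed.

Lemma mpoly_to_polyC c : mpoly_to_poly (n := n) a c%:MP = c%:MP%:P.
Proof. by rewrite /mpoly_to_poly mmapC. Qed.

Lemma mpoly_to_polyX0 : mpoly_to_poly (n := n) a 'X_ord0 = 'X + a%:MP%:P.
Proof. by rewrite /mpoly_to_poly mmapXU unlift_none. Qed.

Lemma mpoly_to_polyXS j :
  mpoly_to_poly (n := n) a 'X_(lift ord0 j) = ('X_j)%:P.
Proof. by rewrite /mpoly_to_poly mmapXU liftK. Qed.

Lemma mpoly_to_polyK : cancel (mpoly_to_poly (n := n) a) (poly_to_mpoly a).
Proof.
apply: (@mpoly_rmorph_ext _ _ _ (poly_to_mpoly a \o mpoly_to_poly a) idfun).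
  by move=> c /=; rewrite mpoly_to_polyC poly_to_mpolyC mmapC.
move=> i /=; case: (unliftP ord0 i) => [j ->|->].
  by rewrite mpoly_to_polyXS poly_to_mpolyC mmapXU.
by rewrite mpoly_to_polyX0 rmorphD /= poly_to_mpolyX poly_to_mpolyC mmapC subrK.
Qed.

Lemma poly_to_mpolyK : cancel (poly_to_mpoly (n := n) a) (mpoly_to_poly a).
Proof.
apply: (@poly_rmorph_ext _ _ (mpoly_to_poly a \o poly_to_mpoly a) idfun).
  move=> c /=; rewrite poly_to_mpolyC; move: c.
  apply: (@mpoly_rmorph_ext _ _ _ (mpoly_to_poly a \o mmap _ _) (@polyC _)).
    by move=> c /=; rewrite mmapC mpoly_to_polyC.
  by move=> i /=; rewrite mmapXU mpoly_to_polyXS.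
by rewrite /= poly_to_mpolyX rmorphB /= mpoly_to_polyX0 mpoly_to_polyC addrK.
Qed.

End MPolyPoly.

Lemma noetherian_mpoly (n : nat) (A : comNzRingType) :
  noetherian A -> noetherian {mpoly A[n]}.
Proof.
move=> noA; elim: n => [|n IH].
  apply: (noetherian_surj (h := @mpolyC 0 A)) noA => p.
  by exists p@_0%MM; rewrite [RHS]nvar0_mpolyC.
apply: (noetherian_surj (h := poly_to_mpoly (n := n) (0 : A))).
  by move=> p; exists (mpoly_to_poly 0 p); exact: mpoly_to_polyK.
exact: noetherian_poly.
Qed.

(** * Equations of the Rees algebra *)

(** A monomial of degree q becomes a product of q linear forms, and its coefficient contributes
    degree 0. *)
Lemma mmap_homog (A B : comNzRingType) (s t : nat)
    (h : {rmorphism A -> {mpoly B[t]}}) (w : 'I_s -> {mpoly B[t]}) q P :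
  (forall c, h c \is 0.-homog) -> (forall i, w i \is 1.-homog) ->
  P \is q.-homog -> mmap h w P \is q.-homog.
Proof.
move=> h0 w1 /dhomogP Pq; rewrite /mmap big_seq; apply: rpred_sum => m /Pq /= <-.
rewrite -[mdeg m]add0n; apply: dhomogM (h0 _) _; rewrite mdegE /mmap1.
elim/big_rec2: _ => [|i d p _ hp]; first exact: dhomog1.
by apply: dhomogM hp; have := dhomogMn (m i) (w1 i); rewrite mul1n.
Qed.

HB.instance Definition _ A s f :=
  GRing.RMorphism.copy (@rees_map A s f)
    (mmap (@polyC A) (fun i => (f i)%:P * 'X)).

Section Rees.
Variables (A : comNzRingType) (s : nat) (f : 'I_s -> A).
Implicit Types P Q : {mpoly A[s]}.

Lemma rees_mapC c : rees_map f c%:MP = c%:P.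
Proof. by rewrite /rees_map mmapC. Qed.

Lemma rees_mapXU i : rees_map f 'X_i = (f i)%:P * 'X.
Proof. by rewrite /rees_map mmapXU. Qed.

Lemma rees_ker_ideal : is_ideal (rees_ker f).
Proof.
rewrite /rees_ker; split=> [|P Q Pk Qk|P Q Qk]; first by rewrite rmorph0.
  by rewrite rmorphD /= Pk Qk addr0.
by rewrite rmorphM /= Qk mulr0.
Qed.

Lemma rees_map_homog P q j : P \is q.-homog -> j != q -> (rees_map f P)`_j = 0.
Proof.
move=> /dhomogP Pq jq; rewrite /rees_map /mmap coef_sum big_seq big1 // => m.
move/Pq => /= dm; rewrite -dm in jq.
rewrite coefCM [X in _ * X](_ : _ = 0) ?mulr0 //.
have -> : mmap1 (fun i => (f i)%:P * 'X) m =
    (\prod_i f i ^+ m i)%:P * 'X^(mdeg m).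
  rewrite /mmap1 rmorph_prod mdegE -prodrXr -big_split.
  by apply: eq_bigr => i _ /=; rewrite exprMn rmorphXn.
by rewrite coefCM coefXn (negbTE jq) mulr0.
Qed.

(** The ideal of equations is graded: the Rees map is graded, so the coefficient of degree d of the
    image comes only from the component of degree d. *)
Lemma rees_ker_pihomog P d : rees_ker f P -> rees_ker f (pihomog mdeg d P).
Proof.
move=> Pk; apply/polyP => j; rewrite coef0; case: (eqVneq j d) => [->|jd].
  (* The maximum keeps d in the range of the decomposition even when it exceeds the degree of P. *)
  have le_P : (msize P <= maxn (msize P) d.+1)%N by rewrite leq_maxl.
  have lt_d : (d < maxn (msize P) d.+1)%N by rewrite leq_maxr.
  have := congr1 (fun p : {poly A} => p`_d) Pk; rewrite coef0.
  rewrite [X in rees_map f X](pihomog_partitionE le_P) rmorph_sum coef_sum.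
  rewrite (bigD1 (Ordinal lt_d)) //= big1 ?addr0 // => e ed.
  by apply: rees_map_homog (pihomogP _ _ _) _; rewrite eq_sym.
exact: rees_map_homog (pihomogP _ _ _) jd.
Qed.

Lemma rees_ker_gen_upto_leq M N :
  (M <= N)%N -> rees_ker_gen_upto f M -> rees_ker_gen_upto f N.
Proof.
move=> le_MN genM P /genM; apply: ideal_gen_mono => Q [Qk [q le_q Qq]].
by split=> //; exists q => //; apply: leq_trans le_MN.
Qed.

(** The ideal of equations is finitely generated, and the homogeneous components of its generators
    are again equations, of bounded degree. A least bound then exists. *)
Lemma has_relation_type_ex : noetherian A ->
  exists N, has_relation_type (ideal_of f) N.
Proof.
move=> /(@noetherian_mpoly s) /(_ _ rees_ker_ideal) [g gP].
pose N := (\max_(p <- g) msize p)%N.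
have genN : rees_ker_gen_upto f N.
  move=> P /gP; apply: ideal_gen_min => [|Q Qg]; first exact: ideal_gen_ideal.
  rewrite (pihomog_partitionE (leqnn (msize Q))).
  apply: ideal_sum => [|d]; first exact: ideal_gen_ideal.
  apply: ideal_gen_sub; split.
    by apply/rees_ker_pihomog/gP/ideal_gen_sub.
  exists d; last exact: pihomogP.
  by apply: leq_trans (ltnW (ltn_ord d)) _; apply: leq_bigmax_seq.
have [|M [M0 genM] M_min] := @ex_minimal _
    (fun M => (1 <= M)%N /\ rees_ker_gen_upto f M) id.
  (* The successor makes the bound positive even if [N] is 0. *)
  by exists N.+1; split=> //; apply: rees_ker_gen_upto_leq genN.
by exists M, s, f; split=> // M' M'0 genM'; apply: M_min.
Qed.

End Rees.

(** * Transport of equations along ring homomorphisms *)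

Section BaseChange.
Variables (A B : comNzRingType) (h : {rmorphism A -> B}) (s t : nat).
Variables (f : 'I_s -> A) (g : 'I_t -> B).

Lemma rees_map_mmap (w : 'I_s -> {mpoly B[t]}) P :
  (forall i, rees_map g (w i) = (h (f i))%:P * 'X) ->
  rees_map g (mmap (@mpolyC t B \o h) w P) = map_poly h (rees_map f P).
Proof.
move=> gw; move: P; apply: (@mpoly_rmorph_ext _ _ _
    (rees_map g \o mmap (@mpolyC t B \o h) w) (map_poly h \o rees_map f)).
  by move=> c /=; rewrite mmapC /= !rees_mapC map_polyC.
by move=> i /=; rewrite mmapXU gw rees_mapXU rmorphM /= map_polyC map_polyX.
Qed.

Lemma rees_ker_mmap (w : 'I_s -> {mpoly B[t]}) P :
  (forall i, rees_map g (w i) = (h (f i))%:P * 'X) ->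
  rees_ker f P -> rees_ker g (mmap (@mpolyC t B \o h) w P).
Proof. by rewrite /rees_ker => /rees_map_mmap -> ->; rewrite rmorph0. Qed.

Lemma mmap_mpolyC_homog (w : 'I_s -> {mpoly B[t]}) q P :
  (forall i, w i \is 1.-homog) -> P \is q.-homog ->
  mmap (@mpolyC t B \o h) w P \is q.-homog.
Proof.
move=> w1; apply: mmap_homog => // c /=.
by rewrite -alg_mpolyC; apply/rpredZ/dhomog1.
Qed.

End BaseChange.

(** A degree-preserving ring map that carries the equations of [g] onto those of [f] carries
    low-degree generators to low-degree generators. It serves both for isomorphisms and for setting
    a variable to 0. *)
Lemma rees_ker_gen_upto_preim (A B : comNzRingType) (s t : nat)
    (f : 'I_s -> A) (g : 'I_t -> B) (N : nat)
    (p : {rmorphism {mpoly B[t]} -> {mpoly A[s]}}) :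
  (forall P, rees_ker f P -> exists2 Q, rees_ker g Q & p Q = P) ->
  (forall Q, rees_ker g Q -> rees_ker f (p Q)) ->
  (forall q Q, Q \is q.-homog -> p Q \is q.-homog) ->
  rees_ker_gen_upto g N -> rees_ker_gen_upto f N.
Proof.
move=> pK pk pq genN P /pK[Q /genN + <-].
apply: (@ideal_gen_min _ (fun Q => ideal_gen _ (p Q))) => [|R [Rk [q le_q Rq]]].
  exact/ideal_preim/ideal_gen_ideal.
by apply: ideal_gen_sub; split; [apply: pk | exists q => //; apply: pq].
Qed.

Section Iso.
Variables (A B : comNzRingType) (h : {rmorphism A -> B}) (h' : {rmorphism B -> A}).
Hypotheses (hK : cancel h h') (h'K : cancel h' h).

Lemma rees_ker_gen_upto_iso (s : nat) (f : 'I_s -> A) (g : 'I_s -> B) N :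
  (forall i, g i = h (f i)) -> rees_ker_gen_upto f N -> rees_ker_gen_upto g N.
Proof.
move=> gE.
apply: (@rees_ker_gen_upto_preim _ _ _ _ _ _ _
          (mmap (@mpolyC s B \o h) (fun i => 'X_i))) => [P Pk|Q|q Q].
- exists (mmap (@mpolyC s A \o h') (fun i => 'X_i) P).
    by apply: rees_ker_mmap Pk => i; rewrite rees_mapXU gE hK.
  move: P {Pk}; apply: (@mpoly_rmorph_ext _ _ _ (mmap _ _ \o mmap _ _) idfun).
    by move=> c /=; rewrite !mmapC /= h'K.
  by move=> i /=; rewrite !mmapXU.
- by apply: rees_ker_mmap => i; rewrite rees_mapXU gE.
- by apply: mmap_mpolyC_homog => i; rewrite dhomogX /= mdeg1.
Qed.

End Iso.

Lemma has_relation_type_ext (A : comNzRingType) (J J' : A -> Prop) N :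
  (forall a, J a <-> J' a) -> has_relation_type J N -> has_relation_type J' N.
Proof.
move=> JJ' [s [f [Jf N0 genN N_min]]]; exists s, f; split=> // a.
by rewrite -JJ' Jf.
Qed.

Lemma has_relation_type_iso (A B : comNzRingType) (h : {rmorphism A -> B})
    (h' : {rmorphism B -> A}) (J : A -> Prop) N :
  cancel h h' -> cancel h' h ->
  has_relation_type J N -> has_relation_type (fun b => J (h' b)) N.
Proof.
move=> hK h'K [s [f [Jf N0 genN N_min]]]; exists s, (h \o f); split=> // [b||M M0 gM].
- split=> [|].
    rewrite -{2}[b]h'K => /Jf; move: (h' b) => a.
    apply: (@ideal_of_min _ (fun a => ideal_of (h \o f) (h a))) => [|i].
      exact/ideal_preim/ideal_of_ideal.
    exact: (@ideal_of_gen _ _ (h \o f)).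
  move=> Jb; apply/Jf; move: Jb.
  apply: (@ideal_of_min _ (fun b => ideal_of f (h' b))) => [|i /=].
    exact/ideal_preim/ideal_of_ideal.
  by rewrite hK; apply: ideal_of_gen.
- exact: (rees_ker_gen_upto_iso hK h'K).
- by apply: N_min => //; apply: (rees_ker_gen_upto_iso h'K hK) gM => i /=; rewrite hK.
Qed.

(** * Adjoining a variable to an ideal *)

Definition consX (A : comNzRingType) (s : nat) (f : 'I_s -> A) (i : 'I_s.+1) :
    {poly A} :=
  oapp (fun j => (f j)%:P) 'X (unlift ord0 i).

Definition widenX (A : comNzRingType) (s : nat) :
    {mpoly A[s]} -> {mpoly {poly A}[s.+1]} :=
  mmap (@mpolyC s.+1 {poly A} \o @polyC A) (fun j => 'X_(lift ord0 j)).

HB.instance Definition _ A s :=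
  GRing.RMorphism.copy (@widenX A s)
    (mmap (@mpolyC s.+1 {poly A} \o @polyC A) (fun j => 'X_(lift ord0 j))).

(* In {mpoly {poly A}[s.+1]}, 'X plays z, 'X_ord0 plays u and 'X_(lift ord0 j)
   plays t_j; a normal form is z * zpart g + tpart h, with g in A[z][u] and h in
   A[t][u]. *)
Definition zpart (A : comNzRingType) (s : nat) :
    {poly {poly A}} -> {mpoly {poly A}[s.+1]} :=
  horner_eval 'X_ord0 \o map_poly (@mpolyC s.+1 {poly A}).

HB.instance Definition _ A s :=
  GRing.RMorphism.copy (@zpart A s)
    (horner_eval 'X_ord0 \o map_poly (@mpolyC s.+1 {poly A})).

Definition tpart (A : comNzRingType) (s : nat) :
    {poly {mpoly A[s]}} -> {mpoly {poly A}[s.+1]} :=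
  horner_eval 'X_ord0 \o map_poly (@widenX A s).

HB.instance Definition _ A s :=
  GRing.RMorphism.copy (@tpart A s)
    (horner_eval 'X_ord0 \o map_poly (@widenX A s)).

Section AdjoinVariable.
Variables (A : comNzRingType) (s : nat) (f : 'I_s -> A).

Lemma consX0 : consX f ord0 = 'X.
Proof. by rewrite /consX unlift_none. Qed.

Lemma consXS j : consX f (lift ord0 j) = (f j)%:P.
Proof. by rewrite /consX liftK. Qed.

(** Modulo ['X], a polynomial equals its constant term. *)
Lemma ideal_of_consX (p : {poly A}) : ideal_of (consX f) p <-> ideal_of f p.[0].
Proof.
have [J0 JD JM] := ideal_of_ideal (consX f).
have If := ideal_of_ideal f.
split=> [|fp].
  apply: (@ideal_of_min _ (fun p => ideal_of f (horner_eval 0 p))) => [|i].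
    exact: ideal_preim.
  case: (unliftP ord0 i) => [j ->|->]; rewrite /horner_eval.
    by rewrite consXS hornerC; apply: ideal_of_gen.
  by rewrite consX0 hornerX; case: If.
have [p' ->] : exists p', p = p' * 'X + (p.[0])%:P.
  elim/poly_ind: p {fp} => [|p c _]; first by exists 0; rewrite hornerC mul0r addr0.
  by exists p; rewrite !hornerE.
apply: JD; first by apply: JM; rewrite -consX0; apply: ideal_of_gen.
move: fp; move: (p.[0]) => a.
apply: (@ideal_of_min _ (fun a => ideal_of (consX f) a%:P)) => [|i].
  exact: (@ideal_preim _ _ (@polyC A) _ (ideal_of_ideal _)).
by rewrite -consXS; apply: ideal_of_gen.
Qed.

Local Notation eps := (@widenX A s).

Let epsC c : eps c%:MP = (c%:P)%:MP.
Proof. by rewrite /widenX mmapC. Qed.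

Let epsXU j : eps 'X_j = 'X_(lift ord0 j).
Proof. by rewrite /widenX mmapXU. Qed.

Let rees_ker_eps P : rees_ker f P -> rees_ker (consX f) (eps P).
Proof. by apply: rees_ker_mmap => i; rewrite rees_mapXU consXS. Qed.

(** Setting z = u = 0 respects equations and degrees, and [widenX] is a section of it. *)
Lemma rees_ker_gen_upto_consX_inv N :
  rees_ker_gen_upto (consX f) N -> rees_ker_gen_upto f N.
Proof.
pose w (i : 'I_s.+1) : {mpoly A[s]} := oapp (fun j => 'X_j) 0 (unlift ord0 i).
apply: (@rees_ker_gen_upto_preim _ _ _ _ _ _ _
          (mmap (@mpolyC s A \o horner_eval (0 : A)) w)) => [P Pk|Q|q Q].
- exists (eps P); first exact: rees_ker_eps.
  move: P {Pk}; apply: (@mpoly_rmorph_ext _ _ _ (mmap _ _ \o eps) idfun).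
    by move=> c /=; rewrite epsC mmapC /= /horner_eval hornerC.
  by move=> i /=; rewrite epsXU mmapXU /w liftK.
- apply: rees_ker_mmap => i; rewrite /w; case: (unliftP ord0 i) => [j ->|->] /=.
    by rewrite rees_mapXU consXS /horner_eval hornerC.
  by rewrite rmorph0 consX0 /horner_eval hornerX mul0r.
- apply: mmap_mpolyC_homog => i; rewrite /w; case: (unlift ord0 i) => [j|] /=.
    by rewrite dhomogX /= mdeg1.
  exact: dhomog0.
Qed.

Let u : {mpoly {poly A}[s.+1]} := 'X_ord0.
Let z : {mpoly {poly A}[s.+1]} := 'X%:MP.
Let cst a : {mpoly {poly A}[s.+1]} := (a%:P)%:MP.

Local Notation zpart := (@zpart A s).
Local Notation tpart := (@tpart A s).

Let zpartC c : zpart c%:P = c%:MP.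
Proof. by rewrite /zpart /= map_polyC /= /horner_eval hornerC. Qed.

Let zpartX : zpart 'X = u.
Proof. by rewrite /zpart /= map_polyX /horner_eval hornerX. Qed.

Let tpartC c : tpart c%:P = eps c.
Proof. by rewrite /tpart /= map_polyC /= /horner_eval hornerC. Qed.

Let tpartX : tpart 'X = u.
Proof. by rewrite /tpart /= map_polyX /horner_eval hornerX. Qed.

(** * Normal forms modulo the linear equations *)

Section NormalForm.
Variable W : {mpoly {poly A}[s.+1]} -> Prop.
Hypothesis idW : is_ideal W.
Hypothesis relW : forall j, W (z * 'X_(lift ord0 j) - cst (f j) * u).

Let nf P := exists g h, W (P - (z * zpart g + tpart h)).

Let W0 : W 0. Proof. by case: idW. Qed.
Let WD P Q : W P -> W Q -> W (P + Q). Proof. by case: idW => _ + _; apply. Qed.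
Let WM P Q : W Q -> W (P * Q). Proof. by case: idW => _ _; apply. Qed.

Let nf_congr P Q : nf Q -> W (P - Q) -> nf P.
Proof.
move=> [g [h WQ]] WPQ; exists g, h.
by rewrite -(subrK Q P) -addrA; apply: WD.
Qed.

Let nfD P Q : nf P -> nf Q -> nf (P + Q).
Proof.
move=> [g [h WP]] [g' [h' WQ]]; exists (g + g'), (h + h').
have := WD WP WQ; congr (W _); rewrite !rmorphD /=.
by move: (zpart _) (zpart _) (tpart _) (tpart _) => a b c d; ring.
Qed.

Let nf_cst a P : nf P -> nf (cst a * P).
Proof.
move=> [g [h WP]]; exists (a%:P%:P * g), (a%:MP%:P * h).
have := WM (cst a) WP; congr (W _).
rewrite !rmorphM /= zpartC tpartC epsC -/(cst a).
by move: (zpart _) (tpart _) (cst a) => b c d; ring.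
Qed.

Let nf_u P : nf P -> nf (u * P).
Proof.
move=> [g [h WP]]; exists ('X * g), ('X * h).
have := WM u WP; congr (W _); rewrite !rmorphM /= zpartX tpartX.
by move: (zpart _) (tpart _) => b c; ring.
Qed.

Let nf_tpart h : nf (tpart h).
Proof. by exists 0, h; rewrite rmorph0 mulr0 add0r subrr. Qed.

(** The factor z is missing here, so each coefficient in A[z] is split as p z + c: the constant c
    goes to the t-part. *)
Let nf_zpart g : nf (zpart g).
Proof.
elim/poly_ind: g => [|g p IH]; first by exists 0, 0; rewrite !rmorph0 mulr0 addr0 subrr.
rewrite rmorphD rmorphM /= zpartX zpartC mulrC; apply: nfD; first exact: nf_u.
elim/poly_ind: p => [|p c _].
  by rewrite mpolyC0; exists 0, 0; rewrite !rmorph0 mulr0 addr0 subrr.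
exists (p%:P), (c%:MP%:P).
by rewrite zpartC tpartC epsC mpolyCD mpolyCM [_ * 'X%:MP]mulrC subrr.
Qed.

(** Multiplying the z-part by t_j creates z t_j, which the relation replaces by f_j u. *)
Let nf_t j P : nf P -> nf ('X_(lift ord0 j) * P).
Proof.
move=> [g [h WP]].
apply: (@nf_congr _ (cst (f j) * (u * zpart g) + tpart (('X_j)%:P * h))).
  by apply: nfD (nf_tpart _); apply/nf_cst/nf_u/nf_zpart.
have := WD (WM 'X_(lift ord0 j) WP) (WM (zpart g) (relW j)); congr (W _).
rewrite rmorphM /= tpartC epsXU.
by move: (zpart _) (tpart _) (cst _) 'X_(lift ord0 j) => a b c d; ring.
Qed.

(** On a constant, z stays and gives a z-part. On a multiple of some t_j, z t_j becomes f_j u and z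
    disappears. *)
Let nf_z_eps c : nf (z * eps c).
Proof.
elim/mpoly_ring_ind: c => [|p q IHp IHq|a p IH|j p IH].
- by exists 1, 0; rewrite !rmorph1 rmorph0 addr0 subrr.
- by rewrite (_ : eps (p + q) = eps p + eps q) ?rmorphD // mulrDr; apply: nfD.
- by rewrite rmorphM /= epsC -/(cst a) mulrCA; apply: nf_cst.
apply: (@nf_congr _ (cst (f j) * (u * eps p))).
  by apply/nf_cst/nf_u; rewrite -tpartC; apply: nf_tpart.
rewrite rmorphM /= epsXU; have := WM (eps p) (relW j); congr (W _).
by move: (eps p) (cst _) 'X_(lift ord0 j) => a b c; ring.
Qed.

(** The z-part absorbs a further z into its coefficients; the t-part is handled by induction on its
    degree in u. *)
Let nf_z P : nf P -> nf (z * P).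
Proof.
move=> [g [h WP]].
apply: (@nf_congr _ (z * zpart ('X%:P * g) + z * tpart h)); last first.
  have := WM z WP; congr (W _); rewrite rmorphM /= zpartC -/z.
  by move: (zpart _) (tpart _) => a b; ring.
apply: nfD; first by exists ('X%:P * g), 0; rewrite rmorph0 addr0 subrr.
elim/poly_ind: h {WP} => [|h c IH].
  by exists 0, 0; rewrite !rmorph0 mulr0 addr0 subrr.
rewrite rmorphD rmorphM /= tpartX tpartC mulrDr; apply: nfD (nf_z_eps c).
by rewrite mulrA mulrC; apply: nf_u.
Qed.

(** Normal forms are stable under sums and under multiplication by constants, z, u and each t_j. [W]
    is left general so as to become the ideal generated by the equations of degree at most N. *)
Lemma rees_normal_form P : exists g h, W (P - (z * zpart g + tpart h)).
Proof.
change (nf P).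
elim/mpoly_ring_ind: P => [|p q IHp IHq|c p IH|i p IH].
- by exists 0, 1; rewrite rmorph0 !rmorph1 mulr0 add0r subrr.
- exact: nfD.
- elim/poly_ind: c => [|c a IHc].
    by rewrite mpolyC0 mul0r -(rmorph0 tpart); apply: nf_tpart.
  rewrite mpolyCD mpolyCM mulrDl -mulrA mulrCA; apply: nfD; first exact: nf_z.
  exact: nf_cst.
- case: (unliftP ord0 i) => [j ->|->]; [exact: nf_t | exact: nf_u].
Qed.

End NormalForm.

(** * Rees images of normal forms *)

Let zTE : rees_map (consX f) u = 'X%:P * 'X.
Proof. by rewrite rees_mapXU consX0. Qed.

(** In [{poly {poly A}}] the outer variable is the Rees variable T and the inner one is z; u is sent
    to z T. *)
Let rees_map_zpart g :
  rees_map (consX f) (zpart g) = (map_poly (@polyC _) g).['X%:P * 'X].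
Proof.
move: g; apply: (@poly_rmorph_ext _ _ (rees_map (consX f) \o zpart)
  (horner_eval ('X%:P * 'X) \o map_poly (@polyC {poly A}))) => [c|] /=.
  by rewrite zpartC rees_mapC map_polyC /horner_eval hornerC.
by rewrite zpartX zTE map_polyX /horner_eval hornerX.
Qed.

Let rees_map_tpart h :
  rees_map (consX f) (tpart h) =
  (map_poly (map_poly (@polyC A) \o rees_map f) h).['X%:P * 'X].
Proof.
move: h; apply: (@poly_rmorph_ext _ _ (rees_map (consX f) \o tpart)
  (horner_eval ('X%:P * 'X) \o map_poly (map_poly (@polyC A) \o rees_map f)))
  => [c|] /=.
  rewrite tpartC map_polyC /horner_eval hornerC /=.
  by apply: rees_map_mmap => i; rewrite rees_mapXU consXS.
by rewrite tpartX zTE map_polyX /horner_eval hornerX.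
Qed.

(** The length n of the sum is free, so that it can be taken to include the one index that
    contributes. *)
Let coef_hornerCX (R : comNzRingType) (p : {poly {poly R}}) (c : R) n q :
  (size p <= n)%N ->
  (p.[c%:P * 'X])`_q =
    \sum_(i < n) (if (q < i)%N then 0 else (p`_i)`_(q - i) * c ^+ i).
Proof.
move=> le_n; rewrite (horner_coef_wide _ le_n) coef_sum; apply: eq_bigr => i _.
rewrite exprMn -rmorphXn mulrA coefMXn; case: ltnP => // _.
by rewrite coefMC.
Qed.

Let coef_zpart g q : (rees_map (consX f) (zpart g))`_q = g`_q * 'X^q.
Proof.
rewrite rees_map_zpart; set p := map_poly _ g.
have lt_q : (q < maxn (size p) q.+1)%N by rewrite leq_maxr.
rewrite (@coef_hornerCX _ _ _ (maxn (size p) q.+1)) ?leq_maxl //.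
rewrite (bigD1 (Ordinal lt_q)) //= ltnn subnn coef_map /= coefC eqxx.
rewrite big1 ?addr0 // => i iq; case: ltnP => // le_iq.
rewrite coef_map /= coefC subn_eq0 leqNgt ltn_neqAle le_iq andbT.
by rewrite (_ : _ != _ = true) ?mul0r.
Qed.

(** Only u brings in z here, through z T, so the power of z singles out the coefficient of h at
    u^m. *)
Let coef_tpart h q m : ((rees_map (consX f) (tpart h))`_q)`_m =
  if (q < m)%N then 0 else (rees_map f h`_m)`_(q - m).
Proof.
rewrite rees_map_tpart; set p := map_poly _ h.
have lt_m : (m < maxn (size p) m.+1)%N by rewrite leq_maxr.
rewrite (@coef_hornerCX _ _ _ (maxn (size p) m.+1)) ?leq_maxl // coef_sum.
have E i : p`_i = map_poly (@polyC A) (rees_map f h`_i) by rewrite coef_map.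
rewrite (bigD1 (Ordinal lt_m)) //= big1 ?addr0 => [|i im].
  by case: ltnP => // _; rewrite ?coef0 // E coef_map /= coefCM coefXn eqxx mulr1.
case: ltnP => // _; rewrite ?coef0 // E coef_map /= coefCM coefXn.
by rewrite (_ : (m == i) = false) ?mulr0 //; rewrite eq_sym; apply/negbTE.
Qed.

Lemma rees_ker_gen_upto_consX N : (1 <= N)%N ->
  rees_ker_gen_upto f N -> rees_ker_gen_upto (consX f) N.
Proof.
move=> N0 genN P Pk; set W := ideal_gen _.
have idW : is_ideal W by apply: ideal_gen_ideal.
have Wk Q : W Q -> rees_ker (consX f) Q.
  by apply: ideal_gen_min => [|R []//]; apply: rees_ker_ideal.
have [j|g [h Wgh]] := rees_normal_form idW _ P.
  apply: ideal_gen_sub; split.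
    rewrite /rees_ker rmorphB !rmorphM /= zTE rees_mapXU !rees_mapC consXS.
    by apply/eqP; rewrite subr_eq0; apply/eqP; ring.
  (* The relations z t_j - f_j u have degree 1, which is allowed because N is positive. *)
  exists 1%N => //; apply: rpredB; rewrite mul_mpolyC; apply: rpredZ.
    by rewrite dhomogX /= mdeg1.
  by rewrite dhomogX /= mdeg1.
have nfk : rees_ker (consX f) (z * zpart g + tpart h).
  have := idealB (rees_ker_ideal _) Pk (Wk _ Wgh).
  by rewrite opprB addrC subrK.
(* Coefficient of z^m T^q. The z-part only has powers of z above q, the t-part only powers up to
   q. *)
have E q m : ('X * (g`_q * 'X^q))`_m +
    (if (q < m)%N then 0 else (rees_map f h`_m)`_(q - m)) = 0.
  have := congr1 (fun p : {poly {poly A}} => (p`_q)`_m) nfk.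
  rewrite /= !coef0 rmorphD rmorphM /= coefD coefD rees_mapC coefCM coef_zpart.
  by rewrite coef_tpart.
have g0 : g = 0.
  apply/polyP => q; apply/polyP => m; rewrite !coef0.
  (* This power of z exceeds q, so only the coefficient of z^m in g_q remains. *)
  have := E q (m + q).+1; rewrite ltnS leq_addl addr0 coefXM /=.
  by rewrite coefMXn ltnNge leq_addl /= addnK.
have hk i : rees_ker f h`_i.
  (* With g = 0, the coefficient of z^i T^(m+i) is the coefficient of T^m in the Rees image of
     h_i. *)
  apply/polyP => m; have := E (m + i)%N i.
  by rewrite g0 coef0 mul0r mulr0 !coef0 add0r ltnNge leq_addl /= addnK.
have W_eps Q : rees_ker f Q -> W (eps Q).
  move/genN; apply: (@ideal_gen_min _ (fun Q => W (eps Q))) => [|R [Rk [q le_q Rq]]].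
    exact: ideal_preim.
  apply: ideal_gen_sub; split; first exact: rees_ker_eps.
  exists q => //; apply: mmap_mpolyC_homog Rq => i.
  by rewrite dhomogX /= mdeg1.
have Wh : W (tpart h).
  rewrite /tpart /= /horner_eval horner_coef; apply: ideal_sum => // i.
  by rewrite coef_map /= mulrC; case: idW => _ _; apply; apply: W_eps.
rewrite -(subrK (z * zpart g + tpart h) P).
case: idW => _ WD _; apply: WD => //.
by rewrite g0 rmorph0 mulr0 add0r.
Qed.

End AdjoinVariable.

Lemma has_relation_type_horner0 (A : comNzRingType) (J : A -> Prop) N :
  has_relation_type J N -> has_relation_type (fun p : {poly A} => J p.[0]) N.
Proof.
move=> [s [f [Jf N0 genN N_min]]]; exists s.+1, (consX f); split=> //.
- by move=> p; rewrite ideal_of_consX.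
- exact: rees_ker_gen_upto_consX.
- by move=> M M0 /rees_ker_gen_upto_consX_inv; apply: N_min.
Qed.

(** One variable at a time: in the coordinate X = y_0 - a_0, evaluating y_0 at a_0 becomes setting X
    = 0, the case of one adjoined variable. *)
Lemma has_relation_type_meval (A : comNzRingType) (r : nat) (a : 'I_r -> A)
    (J : A -> Prop) N :
  has_relation_type J N ->
  has_relation_type (fun p : {mpoly A[r]} => J p.@[a]) N.
Proof.
move=> JN; elim: r a => [|r IH] a.
  apply: has_relation_type_ext (has_relation_type_iso (h := @mpolyC 0 A)
    (h' := meval a) _ _ JN) => // [c|p]; first by rewrite /= mevalC.
  by rewrite [p]nvar0_mpolyC /= mevalC.
have := has_relation_type_iso (@poly_to_mpolyK r A (a ord0))
  (@mpoly_to_polyK r A (a ord0))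
  (has_relation_type_horner0 (IH (fun j => a (lift ord0 j)))).
apply: has_relation_type_ext => p /=.
rewrite (_ : (mpoly_to_poly _ p).[0].@[_] = p.@[a]) //.
move: p; apply: (@mpoly_rmorph_ext _ _ _
  (meval _ \o (horner_eval 0 \o mpoly_to_poly (a ord0))) (meval a)) => [c|i] /=.
  by rewrite mpoly_to_polyC /horner_eval hornerC !mevalC.
rewrite /horner_eval mevalXU; case: (unliftP ord0 i) => [j ->|->].
  by rewrite mpoly_to_polyXS hornerC mevalXU.
by rewrite mpoly_to_polyX0 !hornerE mevalC.
Qed.

(** * Trinomials *)

Section Trinomials.
Variables (k : fieldType) (n r : nat).
Local Notation R := {mpoly k[n]}.
Local Notation S := {mpoly {mpoly k[n]}[r]}.
Implicit Types p q : S.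

(** This lets the term counts of several polynomials be compared over one common list of
    monomials. *)
Lemma nterms_sub p (t : seq 'X_{1..r}) : uniq t -> {subset msupp p <= t} ->
  nterms p = (\sum_(m <- t) size (msupp p@_m))%N.
Proof.
move=> ut sub; rewrite /nterms [RHS](bigID (fun m => m \in msupp p)) /=.
rewrite [X in (_ + X)%N]big1 => [|m /memN_msupp_eq0->]; last by rewrite msupp0.
rewrite addn0 -[RHS]big_filter; apply: perm_big.
apply: uniq_perm; rewrite ?filter_uniq // => m; rewrite mem_filter.
by case: (boolP (m \in msupp p)) => // /sub.
Qed.

Lemma size_msuppD (p q : R) :
  (size (msupp (p + q)) <= size (msupp p) + size (msupp q))%N.
Proof. by rewrite -size_cat; apply: uniq_leq_size => // m /msuppD_le. Qed.

Lemma ntermsD p q : (nterms (p + q) <= nterms p + nterms q)%N.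
Proof.
pose t := undup (msupp p ++ msupp q).
have ut : uniq t by apply: undup_uniq.
rewrite !(@nterms_sub _ t) // => [|m mq|m mp|m /msuppD_le]; rewrite ?mem_undup //.
- by rewrite -big_split; apply: leq_sum => m _; rewrite mcoeffD size_msuppD.
- by rewrite mem_cat mq orbT.
- by rewrite mem_cat mp.
Qed.

Lemma ntermsN p : nterms (- p) = nterms p.
Proof.
rewrite /nterms (perm_big _ (msuppN p)); apply: eq_bigr => m _.
by rewrite mcoeffN (perm_size (msuppN _)).
Qed.

Lemma nterms_mpolyC (c : R) : nterms (c%:MP : S) = size (msupp c).
Proof.
rewrite /nterms msuppC; case: eqP => [->|_]; first by rewrite big_nil msupp0.
by rewrite big_seq1 mcoeffC eqxx mulr1.
Qed.

Lemma nterms_mpolyX i : nterms ('X_i : S) = 1%N.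
Proof. by rewrite /nterms msuppX big_seq1 mcoeffX eqxx msupp1. Qed.

End Trinomials.

(** * Generators as differences of partial sums *)

Section PartialSums.
Variables (k : fieldType) (n s : nat) (f : 'I_s -> {mpoly k[n]}).

(** Each f_i is padded with zeros to m terms and the blocks are concatenated; f_i is then the sum
    over positions i m up to (i + 1) m. *)
Lemma terms_chain : exists (M : nat) (tau : nat -> {mpoly k[n]})
    (b e : 'I_s -> 'I_M.+1),
  (forall l, (size (msupp (tau l)) <= 1)%N) /\
  forall i, f i = \sum_(l < e i) tau l - \sum_(l < b i) tau l.
Proof.
(* The successor makes the block length positive, so that quotient and remainder by [m] locate a
   term. *)
pose m := (\max_(i < s) size (msupp (f i))).+1.
pose term (i : 'I_s) j : {mpoly k[n]} :=
  if (j < size (msupp (f i)))%N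
  then (f i)@_(nth 0%MM (msupp (f i)) j) *: 'X_[nth 0%MM (msupp (f i)) j] else 0.
pose tau l := oapp (fun i => term i (l %% m)%N) 0 (insub (l %/ m)%N).
have sum_term i : \sum_(j < m) term i j = f i.
  have le_m : (size (msupp (f i)) <= m)%N.
    by rewrite ltnW // ltnS (@leq_bigmax _ (fun i => size (msupp (f i))) i).
  rewrite [RHS]mpolyE (big_nth 0%MM) (big_nat_widen _ _ _ _ _ le_m) [RHS]big_mkcond /=.
  by rewrite big_mkord; apply: eq_bigr => j _.
have le_b (i : 'I_s) : (i * m < (s * m).+1)%N
    by rewrite ltnS leq_pmul2r // ltnW.
have le_e (i : 'I_s) : (i.+1 * m < (s * m).+1)%N
    by rewrite ltnS leq_pmul2r.
exists (s * m)%N, tau, (fun i => Ordinal (le_b i)), (fun i => Ordinal (le_e i)).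
split=> [l|i /=].
  rewrite /tau; case: insub => [i|] /=; last by rewrite msupp0.
  rewrite /term; case: ifP => _; last by rewrite msupp0.
  apply: leq_trans (uniq_leq_size _ (@msuppZ_le _ _ _ _)) _ => //.
  by rewrite msuppX.
rewrite mulSnr big_split_ord /= addrAC subrr add0r -sum_term.
apply: eq_bigr => j _; rewrite /tau divnMDl // divn_small // addn0 modnMDl.
by rewrite modn_small // insubT //= => ?; congr term; apply: val_inj.
Qed.

End PartialSums.

(** * Trinomial generators of the preimage *)

Section Chain.
Variables (k : fieldType) (n s M : nat) (f : 'I_s -> {mpoly k[n]}).
Variables (tau : nat -> {mpoly k[n]}) (b e : 'I_s -> 'I_M.+1).
Local Notation R := {mpoly k[n]}.
Local Notation S := {mpoly {mpoly k[n]}[M.+1]}.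
Implicit Types p q : S.

Hypothesis size_tau : forall l, (size (msupp (tau l)) <= 1)%N.
Hypothesis fE : forall i, f i = \sum_(l < e i) tau l - \sum_(l < b i) tau l.

Definition partial_sum (j : 'I_M.+1) : R := \sum_(l < j) tau l.

Definition chain_gen (i : 'I_(M + (1 + s))) : S :=
  match split i with
  | inl j => 'X_(lift ord0 j) - 'X_(widen_ord (leqnSn M) j) - (tau j)%:MP
  | inr i' =>
    match split i' with
    | inl _ => 'X_ord0
    | inr j => 'X_(e j) - 'X_(b j)
    end
  end.

Lemma chain_gen_step j : ideal_of chain_gen
  ('X_(lift ord0 j) - 'X_(widen_ord (leqnSn M) j) - (tau j)%:MP).
Proof.
have := ideal_of_gen chain_gen (lshift (1 + s) j); rewrite /chain_gen.
by rewrite (unsplitK (inl j)).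
Qed.

Lemma chain_gen_start : ideal_of chain_gen 'X_ord0.
Proof.
have := ideal_of_gen chain_gen (rshift M (lshift s ord0)); rewrite /chain_gen.
by rewrite (unsplitK (inr _)) (unsplitK (inl _)).
Qed.

Lemma chain_gen_end j : ideal_of chain_gen ('X_(e j) - 'X_(b j)).
Proof.
have := ideal_of_gen chain_gen (rshift M (rshift 1 j)); rewrite /chain_gen.
by rewrite (unsplitK (inr _)) (unsplitK (inr _)).
Qed.

Lemma trinomial_chain_gen i : trinomial (chain_gen i).
Proof.
rewrite /trinomial /chain_gen; case: split => [j|i'].
  apply: leq_trans (ntermsD _ _) _; rewrite ntermsN nterms_mpolyC.
  rewrite -[3%N]/(2 + 1)%N; apply: leq_add (size_tau _).
  by apply: leq_trans (ntermsD _ _) _; rewrite ntermsN !nterms_mpolyX.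
case: split => [_|j]; first by rewrite nterms_mpolyX.
by apply: leq_trans (ntermsD _ _) _; rewrite ntermsN !nterms_mpolyX.
Qed.

(** Telescoping: the difference for j + 1 is the one for j plus the step generator, starting from
    y_0. *)
Lemma chain_gen_XsubC j : ideal_of chain_gen ('X_j - (partial_sum j)%:MP).
Proof.
have [J0 JD JM] := ideal_of_ideal chain_gen.
case: j => m lt_m; elim: m lt_m => [|m IH] lt_m.
  rewrite /partial_sum big_ord0 mpolyC0 subr0 (_ : Ordinal lt_m = ord0).
    exact: chain_gen_start.
  exact: val_inj.
have := JD _ _ (IH (ltnW lt_m)) (chain_gen_step (Ordinal (lt_m : m < M)%N)).
rewrite (_ : widen_ord _ _ = Ordinal (ltnW lt_m)); last exact: val_inj.
rewrite (_ : lift _ _ = Ordinal lt_m); last exact: val_inj.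
congr (ideal_of _ _); rewrite /partial_sum /= big_ord_recr /= mpolyCD.
by move: ('X_ _) 'X_(Ordinal lt_m) (_%:MP) (_%:MP) => x y z t; ring.
Qed.

Lemma ideal_of_chain_gen p :
  ideal_of f p.@[partial_sum] <-> ideal_of chain_gen p.
Proof.
have [J0 JD JM] := ideal_of_ideal chain_gen.
have [I0 ID IM] := ideal_of_ideal f.
split=> [fp|].
  have f_chain a : ideal_of f a -> ideal_of chain_gen a%:MP.
    apply: (@ideal_of_min _ (fun a => ideal_of chain_gen a%:MP)) => [|i].
      exact: (@ideal_preim _ _ (@mpolyC M.+1 R) _ (ideal_of_ideal _)).
    (* With a_j the partial sums, f_i = (y_e - y_b) - ((y_e - a_e) - (y_b - a_b)). *)
    have := idealB (ideal_of_ideal _) (chain_gen_end i)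
      (idealB (ideal_of_ideal _) (chain_gen_XsubC (e i)) (chain_gen_XsubC (b i))).
    congr (ideal_of _ _); rewrite fE mpolyCB -/(partial_sum _) -/(partial_sum _).
    by rewrite opprB addrA addrC !addrA; ring.
  (* It remains to see that p - p(a) lies in the ideal, by induction on p. *)
  rewrite -(subrK (p.@[partial_sum])%:MP p); apply: (JD) _ (f_chain _ fp).
  elim/mpoly_ring_ind: p {fp} => [|p q IHp IHq|c p IH|i p IH].
  - by rewrite meval1 mpolyC1 subrr.
  - by rewrite mevalD mpolyCD opprD addrACA; apply: JD.
  - by rewrite mevalM mevalC mpolyCM -mulrBr; apply: JM.
  - rewrite mevalM mevalXU mpolyCM.
    (* Uses y_i p - a_i p(a) = y_i (p - p(a)) + p(a) (y_i - a_i). *)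
    have := JD _ _ (JM 'X_i _ IH) (JM (p.@[partial_sum])%:MP _ (chain_gen_XsubC i)).
    congr (ideal_of _ _).
    by move: {IH} 'X_i (p.@[_])%:MP (partial_sum i)%:MP => x y z; ring.
apply: (@ideal_of_min _ (fun p => ideal_of f p.@[partial_sum])) => [|i].
  exact: (@ideal_preim _ _ (meval partial_sum) _ (ideal_of_ideal _)).
rewrite /chain_gen; case: split => [j|i'].
  rewrite !mevalB !mevalXU mevalC /partial_sum lift0 big_ord_recr /=.
  by rewrite addrAC addrK subrr.
case: split => [_|j]; first by rewrite mevalXU /partial_sum big_ord0.
by rewrite mevalB !mevalXU -fE; apply: ideal_of_gen.
Qed.

End Chain.

Theorem proposition3p5 (k : fieldType) (n s : nat)
    (f : 'I_s -> {mpoly k[n]}) :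
  exists (r : nat)
         (sigma : {lrmorphism {mpoly {mpoly k[n]}[r]} -> {mpoly k[n]} | *%R}),
    [/\ forall a : {mpoly k[n]}, exists p, sigma p = a,
        exists (m : nat) (g : 'I_m -> {mpoly {mpoly k[n]}[r]}),
          (forall j, trinomial (g j)) /\
          (forall p, ideal_of f (sigma p) <-> ideal_of g p)
      & exists N : nat,
          has_relation_type (ideal_of f) N /\
          has_relation_type (fun p => ideal_of f (sigma p)) N].
Proof.
have [M [tau [b [e [size_tau fE]]]]] := terms_chain f.
exists M.+1, (meval (partial_sum tau)); split=> [a||].
- by exists a%:MP; apply: mevalC.
- exists (M + (1 + s))%N, (chain_gen tau b e); split=> [j|p].
    exact: trinomial_chain_gen.
  exact: ideal_of_chain_gen.
- have [N rtN] := has_relation_type_ex f (noetherian_mpoly (@noetherian_field k)).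
  by exists N; split=> //=; apply: has_relation_type_meval.
Qed.
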